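(* Under Assumption 1, there exist constants $c_1,c_2>0$, depending only on the problem data ($A,b,C,c$, the $f_i$ and $W$), such that for every $\lambda\in\mathbb{D}$, \[ \|\lambda-\bar\lambda\|_W\ \le\ \big(c_1+c_2\,\mathcal T(\lambda)^2\big)\,\|\nabla^+ d(\lambda)\|_W , \] where $\bar\lambda=[\lambda]^W_{\Lambda^*}$.
   Context: Standing setup. Consider $\min_{z}\ f(z)=\sum_{i=1}^M f_i(z_i)$ subject to $Az=b$, $Cz\le c$, where $z=(z_1,\dots,z_M)$, $z_i\in\mathbb{R}^{n_i}$, $n=\sum_i n_i$, $A\in\mathbb{R}^{p\times n}$, $C\in\mathbb{R}^{q\times n}$, $b\in\mathbb{R}^p$, $c\in\mathbb{R}^q$, and each $f_i:\mathbb{R}^{n_i}\to\mathbb{R}$ is convex. The rows are partitioned into $\bar M$ blocks: $A$ has blocks $A_{ji}\in\mathbb{R}^{p_j\times n_i}$ and $C$ has blocks $C_{ji}\in\mathbb{R}^{q_j\times n_i}$. A matrix $E\in\{0,1\}^{\bar M\times M}$ is given such that $E_{ji}=0$ implies $A_{ji}=0$ and $C_{ji}=0$; $\bar{\mathcal N}_i=\{j: E_{ji}\neq 0\}$, $\mathcal N_j=\{i:E_{ji}\ne 0\}$. Let $G=\begin{bmatrix}A\\ C\end{bmatrix}$, $g=\begin{bmatrix}b\\ c\end{bmatrix}$, $\lambda=(\nu,\mu)$, $\mathbb{D}=\mathbb{R}^p\times\mathbb{R}^q_+$, $\mathcal L(z,\lambda)=f(z)+\langle\lambda,Gz-g\rangle$,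 $d(\lambda)=\min_{z}\mathcal L(z,\lambda)$, $\nabla d(\lambda)=Gz(\lambda)-g$ with $z(\lambda)$ the unique minimizer of $\mathcal L(\cdot,\lambda)$. $L_{d_i}=\big\|\begin{bmatrix}[A_{ji}]_{j\in\bar{\mathcal N}_i}\\ [C_{ji}]_{j\in\bar{\mathcal N}_i}\end{bmatrix}\big\|^2/\sigma_i$; $W=\mathrm{diag}(W_\nu,W_\mu)$, $W_\nu=\mathrm{diag}\big(\sum_{i\in\mathcal N_j}L_{d_i}I_{p_j};\ j\big)$, $W_\mu=\mathrm{diag}\big(\sum_{i\in\mathcal N_j}L_{d_i}I_{q_j};\ j\big)$, assumed positive definite; $\|x\|_W=\sqrt{x^TWx}$. Assumption 1: (a) each $f_i$ is $\sigma_i$-strongly convex and has $L_i$-Lipschitz gradient (Euclidean norm); (b) $A$ has full row rank and there is $\tilde z$ with $A\tilde z=b$, $C\tilde z<c$. Under Assumption 1 the set $\Lambda^*$ of maximizers of $d$ over $\mathbb{D}$ is nonempty, convex and bounded, and $\max_{\mathbb D} d=f^*$ (the primal optimal value). Notation: $[x]^W_S$ denotes the projection of $x$ onto a closed convex set $S$ with respect to $\|\cdot\|_W$. The proximal residual is $\nabla^+ d(\lambda)=[\lambda+W^{-1}\nabla d(\lambda)]^W_{\mathbb D}-\lambda$ for $\lambda\in\mathbb D$. $\mathcal T(\lambda)=\max_{\lambda^*\in\Lambda^*}\|\lambda-\lambda^*\|_W$. *)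

(* Defs.v *)
From Stdlib Require Import Reals.
From mathcomp Require Import ssreflect ssrfun ssrbool eqtype ssrnat seq fintype bigop.
Set Implicit Arguments.
Unset Strict Implicit.
Open Scope R_scope.

Definition vec (n : nat) := 'I_n -> R.
Definition sumR (n : nat) (F : 'I_n -> R) : R := \big[Rplus/0]_(k < n) F k.
Definition dot n (x y : vec n) : R := sumR (fun k => x k * y k).
Definition norm2 n (x : vec n) : R := sqrt (dot x x).
Definition vadd n (x y : vec n) : vec n := fun k => x k + y k.
Definition vsub n (x y : vec n) : vec n := fun k => x k - y k.
Definition mv m n (A : 'I_m -> 'I_n -> R) (x : vec n) : vec m :=
  fun k => sumR (fun l => A k l * x l).

Definition has_grad n (f : vec n -> R) (x g : vec n) : Prop :=
  forall eps, 0 < eps -> exists delta, 0 < delta /\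
    forall h : vec n, norm2 h < delta ->
      Rabs (f (vadd x h) - f x - dot g h) <= eps * norm2 h.
Definition strongly_convex n (sigma : R) (f : vec n -> R) : Prop :=
  forall (x y : vec n) t, 0 <= t <= 1 ->
    f (fun k => t * x k + (1 - t) * y k)
      <= t * f x + (1 - t) * f y - sigma / 2 * t * (1 - t) * (norm2 (vsub x y)) ^ 2.
Definition lipschitz n m (L : R) (g : vec n -> vec m) : Prop :=
  forall x y, norm2 (vsub (g x) (g y)) <= L * norm2 (vsub x y).

(* Problem data: M column blocks of sizes n_i, Mb row blocks of sizes p_j, q_j *)
Unset Implicit Arguments.
Record problem := Problem {
  M : nat; Mb : nat;
  nb : 'I_M -> nat; pb : 'I_Mb -> nat; qb : 'I_Mb -> nat;
  fb : forall i : 'I_M, vec (nb i) -> R;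
  Ab : forall (j : 'I_Mb) (i : 'I_M), 'I_(pb j) -> 'I_(nb i) -> R;
  Cb : forall (j : 'I_Mb) (i : 'I_M), 'I_(qb j) -> 'I_(nb i) -> R;
  bb : forall j : 'I_Mb, vec (pb j);
  cb : forall j : 'I_Mb, vec (qb j);
  Eb : 'I_Mb -> 'I_M -> bool }.

Section Prob.
Variable P : problem.

Definition pvar := forall i : 'I_(M P), vec (nb P i).
Definition nuvar := forall j : 'I_(Mb P), vec (pb P j).
Definition muvar := forall j : 'I_(Mb P), vec (qb P j).
Definition dvar := (nuvar * muvar)%type.

Definition fsum (z : pvar) : R := \big[Rplus/0]_(i < M P) @fb P i (z i).
Definition Az (z : pvar) : nuvar :=
  fun j k => \big[Rplus/0]_(i < M P) mv (@Ab P j i) (z i) k.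
Definition Cz (z : pvar) : muvar :=
  fun j k => \big[Rplus/0]_(i < M P) mv (@Cb P j i) (z i) k.
Definition nudot (x y : nuvar) : R := \big[Rplus/0]_(j < Mb P) dot (x j) (y j).
Definition mudot (x y : muvar) : R := \big[Rplus/0]_(j < Mb P) dot (x j) (y j).

Definition resA (z : pvar) : nuvar := fun j k => Az z j k - @bb P j k.
Definition resC (z : pvar) : muvar := fun j k => Cz z j k - @cb P j k.

Definition Lagr (z : pvar) (l : dvar) : R :=
  fsum z + nudot l.1 (resA z) + mudot l.2 (resC z).

Definition inD (l : dvar) : Prop := forall j k, 0 <= l.2 j k.

Definition is_lagr_min (l : dvar) (z : pvar) : Prop := forall z', Lagr z l <= Lagr z' l.
Definition dual_val (l : dvar) (v : R) : Prop :=
  (exists z, Lagr z l = v) /\ forall z, v <= Lagr z l.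
Definition Lstar (l : dvar) : Prop :=
  inD l /\ exists v, dual_val l v /\
    forall l' v', inD l' -> dual_val l' v' -> v' <= v.

Definition A_full_row_rank : Prop :=
  forall nu : nuvar,
    (forall (i : 'I_(M P)) (l : 'I_(nb P i)),
        \big[Rplus/0]_(j < Mb P) sumR (fun k => nu j k * @Ab P j i k l) = 0) ->
    forall j k, nu j k = 0.
Definition slater : Prop :=
  exists z : pvar, (forall j k, Az z j k = @bb P j k) /\ (forall j k, Cz z j k < @cb P j k).

Definition E_sparsity : Prop :=
  forall j i, Eb P j i = false ->
    (forall k l, @Ab P j i k l = 0) /\ (forall k l, @Cb P j i k l = 0).

(* opn is the operator 2-norm of [ [A_ji]_{j in Nbar_i} ; [C_ji]_{j in Nbar_i} ] *)
Definition is_opnorm_block (i : 'I_(M P)) (opn : R) : Prop :=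
  is_lub (fun r => exists x : vec (nb P i), norm2 x <= 1 /\
            r = sqrt (\big[Rplus/0]_(j < Mb P | Eb P j i)
                        ((norm2 (mv (@Ab P j i) x)) ^ 2 + (norm2 (mv (@Cb P j i) x)) ^ 2)))
         opn.

Variable Ld : 'I_(M P) -> R.

(* diagonal entry of W on row block j: sum_{i in N_j} L_{d_i} *)
Definition wgt (j : 'I_(Mb P)) : R := \big[Rplus/0]_(i < M P | Eb P j i) Ld i.
Definition Wquad (l : dvar) : R :=
  \big[Rplus/0]_(j < Mb P)
     (wgt j * (sumR (fun k => l.1 j k ^ 2) + sumR (fun k => l.2 j k ^ 2))).
Definition Wnorm (l : dvar) : R := sqrt (Wquad l).
Definition W_posdef : Prop :=
  forall l : dvar, ((exists j k, l.1 j k <> 0) \/ (exists j k, l.2 j k <> 0)) ->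
    0 < Wquad l.

Definition dadd (l l' : dvar) : dvar :=
  (fun j k => l.1 j k + l'.1 j k, fun j k => l.2 j k + l'.2 j k).
Definition dsub (l l' : dvar) : dvar :=
  (fun j k => l.1 j k - l'.1 j k, fun j k => l.2 j k - l'.2 j k).
(* W^{-1} grad d(lambda) = W^{-1} (G z(lambda) - g) *)
Definition Winv_grad (z : pvar) : dvar :=
  (fun j k => resA z j k / wgt j, fun j k => resC z j k / wgt j).

Definition is_Wproj (S : dvar -> Prop) (x y : dvar) : Prop :=
  S y /\ forall y', S y' -> Wnorm (dsub x y) <= Wnorm (dsub x y').

Definition is_T (l : dvar) (T : R) : Prop :=
  (exists ls, Lstar ls /\ T = Wnorm (dsub l ls)) /\
  forall ls, Lstar ls -> Wnorm (dsub l ls) <= T.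

End Prob.

(* Main.v *)
(** Let [z0] be the primal point common to all optimal multipliers. Inside [D],
    [Lambda*] is cut out by the equations [G^T lambda = G^T lambda*] and
    [<G z0 - g, lambda - lambda*> = 0], so with [u = bar lambda - lambda] a Hoffman
    bound gives
      [|u|^2 <= H (|G^T u|^2 + <G z0 - g, u>^2)].
    It is obtained by compactness: [u] being minimal, the homogeneous equations have
    no nonzero solution with the sign pattern of [u], as moving [bar lambda] along
    such a solution would stay in [Lambda*] and get closer to [lambda]; and there
    are finitely many sign patterns.

    Let [r] be the proximal residual. Adding the variational inequalities of the
    projection on [D] and of dual optimality yields [|G^T u|^2 <= C |r| |u|] (strong
    monotonicity and Lipschitz continuity of the gradient of [f]) and
    [0 <= <G z0 - g, u> <= |r| (D + C' |u|)]. Hence [|u| <= C'' (1 + |u|) |r|], and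
    [|u| <= T]. *)

From Stdlib Require Import Reals.
From mathcomp Require Import all_boot all_order all_algebra.
From mathcomp Require Import all_classical all_reals all_analysis.
From mathcomp Require Import Rstruct ring lra.
(* [Defs] comes last because MathComp-Analysis also has a [dadd]. *)
Require Import Defs.

Set Implicit Arguments.
Unset Strict Implicit.
Unset Printing Implicit Defensive.
Import Order.TTheory GRing.Theory Num.Theory numFieldNormedType.Exports.

(** * Weighted inner products and minimisation on compact sets *)

Section InnerProduct.
Local Open Scope classical_set_scope.
Local Open Scope ring_scope.
Variables (R : realType) (J : finType).
Implicit Types (w : J -> R) (x y v : J -> R) (a : R).

Definition wip w x y : R := \sum_j w j * (x j * y j).
Definition wnorm w x : R := Num.sqrt (wip w x x).

Lemma wipC w x y : wip w x y = wip w y x.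
Proof. by apply: eq_bigr => j _; rewrite (mulrC (x j)). Qed.

Lemma wipDl w x y v : wip w (x + y) v = wip w x v + wip w y v.
Proof. by rewrite -big_split; apply: eq_bigr => j _ /=; rewrite fctE; ring. Qed.

Lemma wipZl w a x y : wip w (a *: x) y = a * wip w x y.
Proof.
by rewrite mulr_sumr; apply: eq_bigr => j _; rewrite fctE /GRing.scale /=; ring.
Qed.

Lemma wipNl w x y : wip w (- x) y = - wip w x y.
Proof. by rewrite -sumrN; apply: eq_bigr => j _; rewrite fctE; ring. Qed.

Lemma wipBl w x y v : wip w (x - y) v = wip w x v - wip w y v.
Proof. by rewrite wipDl wipNl. Qed.

Lemma wipDr w x y v : wip w v (x + y) = wip w v x + wip w v y.
Proof. by rewrite !(wipC _ v) wipDl. Qed.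

Lemma wipZr w a x y : wip w y (a *: x) = a * wip w y x.
Proof. by rewrite !(wipC _ y) wipZl. Qed.

Lemma wipNr w x y : wip w y (- x) = - wip w y x.
Proof. by rewrite !(wipC _ y) wipNl. Qed.

Lemma wipBr w x y v : wip w v (x - y) = wip w v x - wip w v y.
Proof. by rewrite !(wipC _ v) wipBl. Qed.

Definition wipE := (wipDl, wipDr, wipNl, wipNr, wipZl, wipZr).

Lemma wip0l w x : wip w 0 x = 0.
Proof. by rewrite -(scale0r 0) wipZl mul0r. Qed.

Lemma wip_ge0 w x : (forall j, 0 < w j) -> 0 <= wip w x x.
Proof.
move=> w0; apply: sumr_ge0 => j _.
by rewrite mulr_ge0 ?(ltW (w0 j))// -expr2 sqr_ge0.
Qed.

Lemma wip_eq0 w x : (forall j, 0 < w j) -> wip w x x = 0 -> x = 0.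
Proof.
move=> w0 /eqP; rewrite psumr_eq0; last first.
  by move=> j _; rewrite mulr_ge0 ?(ltW (w0 j))// -expr2 sqr_ge0.
move=> /allP x0; apply/funext => j; have := x0 j (mem_index_enum j).
by rewrite mulf_eq0 gt_eqF//= mulf_eq0 orbb => /eqP.
Qed.

Lemma wnorm_ge0 w x : 0 <= wnorm w x.
Proof. exact: sqrtr_ge0. Qed.

Lemma wnormE w x : (forall j, 0 < w j) -> wnorm w x ^+ 2 = wip w x x.
Proof. by move=> w0; rewrite sqr_sqrtr// wip_ge0. Qed.

Lemma wip_sqr_le w x y : (forall j, 0 < w j) ->
  wip w x y ^+ 2 <= wip w x x * wip w y y.
Proof.
move=> w0; have [y0|y0] := eqVneq (wip w y y) 0.
  by rewrite (wip_eq0 w0 y0) wipC wip0l expr0n mulr_ge0 ?wip_ge0.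
have yp : 0 < wip w y y by rewrite lt_def y0 wip_ge0.
(* The squared norm of this vector is [<y,y> (<x,x> <y,y> - <x,y>^2)]. *)
have := wip_ge0 (wip w y y *: x - wip w x y *: y) w0.
rewrite !wipE (wipC w y x) => h.
rewrite -subr_ge0 -(pmulr_rge0 _ yp); apply: le_trans h _.
by rewrite le_eqVlt; apply/orP; left; apply/eqP; ring.
Qed.

Lemma wip_le w x y : (forall j, 0 < w j) -> wip w x y <= wnorm w x * wnorm w y.
Proof.
move=> w0; apply: le_trans (ler_norm _) _.
rewrite -ler_sqr ?nnegrE ?mulr_ge0 ?wnorm_ge0//.
by rewrite real_normK ?num_real// exprMn !wnormE// wip_sqr_le.
Qed.

Lemma wnormB w x y : wnorm w (x - y) = wnorm w (y - x).
Proof. by rewrite /wnorm -(opprB y x) wipNl wipNr opprK. Qed.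

Lemma wnormN w x : wnorm w (- x) = wnorm w x.
Proof. by rewrite /wnorm !wipE opprK. Qed.

End InnerProduct.

Notation ip := (wip (fun=> GRing.one _)).
Notation norm := (wnorm (fun=> GRing.one _)).

(** * Continuity and compactness in finite products of the real line *)

Section Continuity.
Local Open Scope classical_set_scope.
Local Open Scope ring_scope.
Variables (R : realType) (J : finType).
Local Notation V := (prod_topology (fun _ : J => R)).

Lemma sum_continuous (I : finType) (F : I -> V -> R) :
  (forall i, continuous (F i)) -> continuous (fun v => \sum_i F i v).
Proof. by move=> Fc; apply: continuous_big => //; exact: add_continuous. Qed.

Lemma coordinate_continuous (j : J) : continuous (fun v : V => v j).
Proof. exact: proj_continuous. Qed.

Lemma mul_continuous (f g : V -> R) :
  continuous f -> continuous g -> continuous (fun v => f v * g v).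
Proof. by move=> fc gc v; exact: (continuousM (fc v) (gc v)). Qed.

Lemma addf_continuous (f g : V -> R) :
  continuous f -> continuous g -> continuous (fun v => f v + g v).
Proof. by move=> fc gc v; exact: (continuousD (fc v) (gc v)). Qed.

Lemma subf_continuous (f g : V -> R) :
  continuous f -> continuous g -> continuous (fun v => f v - g v).
Proof. by move=> fc gc v; exact: (continuousB (fc v) (gc v)). Qed.

Lemma const_continuous (a : R) : continuous (fun _ : V => a).
Proof. by move=> v; exact: cst_continuous. Qed.

Lemma wip_continuous (w : J -> R) (f g : J -> V -> R) :
  (forall j, continuous (f j)) -> (forall j, continuous (g j)) ->
  continuous (fun v : V => wip w (f ^~ v) (g ^~ v)).
Proof.
move=> fc gc; apply: (sum_continuous (F := fun j v => w j * (f j v * g j v))) => j.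
exact: (mul_continuous (@const_continuous (w j)) (mul_continuous (fc j) (gc j))).
Qed.

Lemma closed_le0 (phi : V -> R) : continuous phi -> closed [set v | phi v <= 0].
Proof.
by move=> /continuous_closedP c; exact: (c [set r | r <= 0] (@closed_le _ 0)).
Qed.

(** Serves sign conditions imposed only on the coordinates outside a given set. *)
Lemma closed_guard (b : bool) (A : set V) : closed A -> closed [set v | b -> A v].
Proof.
move=> Acl; case: b.
  by rewrite (_ : [set v | _] = A)//; apply/seteqP; split=> v //= h; exact: h.
by rewrite (_ : [set v | _] = setT); [exact: closedT|apply/seteqP; split].
Qed.

(** [K] is closed in a product of segments, which is compact by Tychonoff's theorem, so the extreme
    value theorem applies. *)
Lemma compact_box_min (K : set V) (b : R) (phi : V -> R) :
  closed K -> (forall v, K v -> forall j, `|v j| <= b) -> K !=set0 ->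
  continuous phi -> exists2 c, K c & forall v, K v -> phi c <= phi v.
Proof.
move=> Kcl Kb K0 phic.
have cB : @compact V [set f | forall j, `[- b, b]%classic (f j)].
  by apply: (@tychonoff J (fun=> R) (fun=> `[- b, b]%classic)) => j;
    exact: segment_compact.
have cK : @compact V K.
  apply: (subclosed_compact Kcl cB) => v Kv j.
  by rewrite /= in_itv/= -ler_norml Kb.
have [c cKc cm] := compact_EVT_min K0 cK (continuous_subspaceT phic).
by exists c => [|v Kv]; [exact: set_mem|exact/cm/mem_set].
Qed.

End Continuity.

(** * Hoffman's bound *)

Section UniformBounds.
Local Open Scope ring_scope.

Lemma uniform_lower_bound (R : realType) (T : finType) (F : T -> R) :
  (forall t, 0 < F t) -> exists2 m, 0 < m & forall t, m <= F t.
Proof.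
move=> F0; exists (\big[Num.min/1]_t F t); last by move=> t; exact: bigmin_le.
by elim/big_ind : _ => // x y x0 y0; rewrite lt_min x0.
Qed.

(** Each [Q t] holds beyond some threshold, so the sum of the positive thresholds suits all [t]; the
    added 1 keeps it positive when [T] is empty. *)
Lemma uniform_upper_bound (R : realType) (T : finType) (Q : T -> R -> Prop) :
  (forall t, exists C, 0 < C /\ forall D, C <= D -> Q t D) ->
  exists2 D, 0 < D & forall t, Q t D.
Proof.
move=> /choice[C hC]; exists (1 + \sum_t C t).
  by rewrite ltr_pwDl// sumr_ge0// => t _; exact/ltW/(hC t).1.
move=> t; apply: (hC t).2; rewrite (bigD1 t)//= addrCA lerDl addr_ge0//.
by rewrite sumr_ge0// => s _; exact/ltW/(hC s).1.
Qed.

End UniformBounds.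

Section Hoffman.
Local Open Scope classical_set_scope.
Local Open Scope ring_scope.
Variables (R : realType) (J : finType) (w : J -> R).
Hypothesis w0 : forall j, 0 < w j.

Local Notation V := (prod_topology (fun _ : J => R)).

(** Where [u j = 0] both clauses apply and force [k j = 0]. *)
Definition conformal (k u : J -> R) :=
  forall j, (u j <= 0 -> k j <= 0) /\ (0 <= u j -> 0 <= k j).

(** The premise depends on [u] only through its sign pattern. For each pattern the form on the right
    is minimised over the unit vectors of the corresponding cone; homogeneity and finiteness of the
    set of patterns do the rest. *)
Lemma hoffman_conformal (I' : finType) (B : I' -> J -> R) :
  exists2 H, 0 < H & forall u : J -> R,
    (forall k, (forall i, ip (B i) k = 0) -> conformal k u -> k = 0) ->
    wip w u u <= H * \sum_i ip (B i) u ^+ 2.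
Proof.
pose q (v : J -> R) := \sum_i ip (B i) v ^+ 2.
have qZ a v : q (a *: v) = a ^+ 2 * q v.
  by rewrite mulr_sumr; apply: eq_bigr => i _; rewrite wipZr exprMn.
have qge0 v : 0 <= q v by apply: sumr_ge0 => i _; exact: sqr_ge0.
have q_eq0 v : q v = 0 -> forall i, ip (B i) v = 0.
  move=> /eqP; rewrite psumr_eq0 => [/allP h i|i _]; last exact: sqr_ge0.
  by have := h i (mem_index_enum i); rewrite sqrf_eq0 => /eqP.
have ipc i : continuous (fun v : V => ip (B i) v).
  apply: (wip_continuous (f := fun j _ => B i j) (g := fun j v => v j)) => j.
    exact: const_continuous.
  exact: coordinate_continuous.
have qc : continuous (q : V -> R).
  apply: (sum_continuous (F := fun i v => ip (B i) v ^+ 2)) => i.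
  exact: (mul_continuous (ipc i) (ipc i)).
have wc : continuous (fun v : V => wip w v v).
  by apply: (wip_continuous (f := fun j v => v j) (g := fun j v => v j)) => j;
    exact: coordinate_continuous.
have [m m0 mw] := uniform_lower_bound w0.
(* [s] records a sign pattern: [s.1] the positive, [s.2] the negative coordinates. *)
pose K (s : {set J} * {set J}) (v : J -> R) :=
  forall j, (j \notin s.1 -> v j <= 0) /\ (j \notin s.2 -> 0 <= v j).
have [H H0 hH] : exists2 H, 0 < H & forall s : {set J} * {set J},
    (forall k, q k = 0 -> K s k -> k = 0) ->
    forall u, K s u -> wip w u u <= H * q u.
  apply: uniform_upper_bound => s.
  (* If the cone contains a nonzero kernel vector, the claim for this pattern is vacuous and any
     constant serves. *)
  have [ker0|kerN0] := pselect (forall k, q k = 0 -> K s k -> k = 0); last first.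
    by exists 1; split.
  pose S : set V := [set v | K s v] `&` [set v | wip w v v = 1].
  have Scl : closed S.
    rewrite (_ : S = \bigcap_(j in [set: J])
        ([set v : V | j \notin s.1 -> v j <= 0] `&` [set v : V | j \notin s.2 -> 0 <= v j])
        `&` ([set v : V | wip w v v - 1 <= 0] `&` [set v : V | 1 - wip w v v <= 0])).
      apply: closedI.
        apply: closed_bigI => j _; apply: closedI.
          apply: (closed_guard _ (A := [set v : V | v j <= 0])).
          by apply: closed_le0; exact: coordinate_continuous.
        apply: (closed_guard _ (A := [set v : V | 0 <= v j])).
        rewrite (_ : [set v : V | 0 <= v j] = [set v | - v j <= 0]).
          by apply: closed_le0 => v; exact: (continuousN (@coordinate_continuous R J j v)).
        by apply/seteqP; split=> v /=; rewrite oppr_le0.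
      by apply: closedI; apply: closed_le0; apply: subf_continuous => //;
        exact: const_continuous.
    apply/seteqP; split => v /=.
      by move=> [Kv ->]; split => [j _|]; [exact: Kv|rewrite subrr].
    move=> [Kv [h1 h2]]; split => [j|]; first exact: Kv.
    by apply/eqP; rewrite eq_le -subr_le0 h1 -subr_le0 h2.
  (* The unit norm gives [v j ^+ 2 <= m^-1]. Either [v j] has modulus at most 1, or its modulus is
     at most its square; this avoids a square root. *)
  have Sb v : S v -> forall j, `|v j| <= 1 + m^-1.
    move=> [_ /= v1] j.
    have : m * v j ^+ 2 <= 1.
      rewrite -v1 /wip (bigD1 j)//= -expr2.
      apply: (@le_trans _ _ (w j * v j ^+ 2)); first by rewrite ler_wpM2r ?sqr_ge0.
      by rewrite lerDl sumr_ge0// => i _;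
        rewrite mulr_ge0 ?(ltW (w0 i))// -expr2 sqr_ge0.
    rewrite -ler_pdivlMl// mulr1 => h.
    have [le1|/ltW ge1] := leP `|v j| 1;
    first by rewrite (le_trans le1)// lerDl invr_ge0 ltW.
    apply: (@le_trans _ _ m^-1); last by rewrite lerDr.
    by apply: le_trans h; rewrite -(real_normK (num_real _)) expr2 ler_peMl.
  have scale u : K s u -> u != 0 -> S ((wnorm w u)^-1 *: u).
    move=> Ku u0.
    have up : 0 < wip w u u.
      by rewrite lt_def wip_ge0// andbT; apply: contra_neq u0; exact: wip_eq0.
    split=> [j|]; last by rewrite /= wipZl wipZr mulrA -expr2 exprVn wnormE// mulVf// gt_eqF.
    rewrite fctE /GRing.scale /=; split=> hj.
      by rewrite mulr_ge0_le0 ?invr_ge0 ?wnorm_ge0 ?(Ku j).1.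
    by rewrite mulr_ge0 ?invr_ge0 ?wnorm_ge0 ?(Ku j).2.
  (* An empty slice means that the cone is reduced to 0. *)
  have [S0|S0] := pselect (S !=set0); last first.
    exists 1; split=> // D D1 _ u Ku; have [->|u0] := eqVneq u 0.
      by rewrite wip0l mulr_ge0// (le_trans _ D1).
    by exfalso; apply: S0; exists ((wnorm w u)^-1 *: u); exact: scale.
  have [c [Kc c1] cmin] := compact_box_min Scl Sb S0 qc.
  (* A zero minimum would put [c] in the kernel, hence [c = 0], against its unit norm. *)
  have qc0 : 0 < q c.
    rewrite lt_def qge0 andbT; apply/eqP => /ker0 /(_ Kc) c0.
    by move: c1; rewrite /= c0 wip0l => /esym/eqP; rewrite oner_eq0.
  exists (q c)^-1; split=> [|D cD _ u Ku]; first by rewrite invr_gt0.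
  have [->|u0] := eqVneq u 0.
    by rewrite wip0l mulr_ge0// (le_trans _ cD)// invr_ge0 ltW.
  have up : 0 < wip w u u.
    by rewrite lt_def wip_ge0// andbT; apply: contra_neq u0; exact: wip_eq0.
  have := cmin _ (scale _ Ku u0).
  rewrite qZ exprVn wnormE// ler_pdivlMl// => h.
  apply: (@le_trans _ _ ((q c)^-1 * q u)); last exact: ler_wpM2r.
  by rewrite ler_pdivlMl// mulrC.
exists H => // u ker0.
pose s := ([set j | 0 < u j]%SET, [set j | u j < 0]%SET).
have Ku : K s u by move=> j; rewrite !inE -!leNgt.
apply: (hH s) => // k qk0 Kk; apply: ker0; first exact: q_eq0.
by move=> j; have := Kk j; rewrite !inE -!leNgt.
Qed.

(** For small [t] every [t * k j] lies between 0 and [u j], so subtracting it enlarges no coordinate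
    in modulus and strictly shrinks those with [k j] nonzero. The bracketing is kept in the
    conclusion because it also yields feasibility of the moved multiplier. *)
Lemma shrink_conformal (k u : J -> R) : k != 0 -> conformal k u ->
  exists2 t, 0 < t & [/\ wip w (u - t *: k) (u - t *: k) < wip w u u
   & forall j, 0 <= t * k j <= u j \/ u j <= t * k j <= 0].
Proof.
move=> kN0 cf.
have k0 j : u j = 0 -> k j = 0.
  by move=> uj; apply/eqP; rewrite eq_le (cf j).1 ?uj// (cf j).2 ?uj.
(* Coordinates with [k j = 0] do not restrict [t]; 1 is an arbitrary positive value there. *)
have Ft j : 0 < (if k j == 0 then 1 else `|u j| / `|k j|).
  have [//|kj] := eqVneq (k j) 0.
  by rewrite divr_gt0// normr_gt0//; apply: contra_neq kj; exact: k0.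
have [t t0 tle] := uniform_lower_bound Ft.
have bd j : 0 <= t * k j <= u j \/ u j <= t * k j <= 0.
  have := tle j; case: (eqVneq (k j) 0) => [->|kj].
    by rewrite !mulr0; case: (lerP 0 (u j)) => [?|/ltW ?]; [left|right]; rewrite lexx ?andbT.
  rewrite ler_pdivlMr ?normr_gt0// => tle_j.
  have [uj|/ltW uj] := leP 0 (u j); [left|right].
    have kj0 := (cf j).2 uj.
    by move: tle_j; rewrite (ger0_norm uj) (ger0_norm kj0) mulr_ge0 ?(ltW t0).
  have kj0 := (cf j).1 uj.
  move: tle_j; rewrite (ler0_norm uj) (ler0_norm kj0) mulrN lerN2 => ->.
  by rewrite mulr_ge0_le0 ?(ltW t0).
exists t => //; split=> //.
have [i ki] : exists i, k i != 0.
  by apply/not_existsP => h; move/eqP: kN0; apply; apply/funext => j; apply/eqP/negPn/negP/h.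
have le1 j : (u j - t * k j) * (u j - t * k j) <= u j * u j.
  by case: (bd j) => /andP[]; move: (t * k j) => a; nra.
rewrite /wip (bigD1 i)//= [ltRHS](bigD1 i)//=; apply: ltr_leD; last first.
  by apply: ler_sum => j _; rewrite ler_wpM2l ?(ltW (w0 j))//; exact: le1.
rewrite ltr_pM2l//.
change ((u i - t * k i) * (u i - t * k i) < u i * u i).
have tk : t * k i != 0 by rewrite mulf_neq0// gt_eqF.
case: (bd i) => /andP[]; move: tk; rewrite neq_lt; move: (t * k i) (u i) => a b.
  move=> /orP[] a0 b0 b1; first by lra.
  have : 0 < a * a by rewrite mulr_gt0.
  have : 0 <= a * (b - a) by rewrite mulr_ge0 ?subr_ge0.
  by nra.
move=> /orP[] a0 b0 b1; last by lra.
have : 0 < a * a by rewrite nmulr_rgt0.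
have : 0 <= a * (b - a) by rewrite mulr_le0 ?subr_le0.
by nra.
Qed.

End Hoffman.

(** * The dual function *)

Section Projection.
Local Open Scope ring_scope.

(** Passage to the limit as [t] tends to 0, the form in which all first-order conditions are
    extracted below. If [a > 0], then [t = a / (a + b)] is a contradiction. *)
Lemma le0_small (R : realFieldType) (a b : R) :
  (forall t, 0 < t -> t <= 1 -> a <= t * b) -> a <= 0.
Proof.
move=> h; rewrite leNgt; apply/negP => a0.
have ab : a <= b by have := h 1 ltr01 (lexx _); rewrite mul1r.
have ab0 : 0 < a + b by lra.
have := h (a / (a + b)) (divr_gt0 a0 ab0).
rewrite ler_pdivrMr// mul1r lerDl (le_trans (ltW a0) ab) => /(_ isT).
rewrite mulrAC ler_pdivlMr// ler_pM2l//; lra.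
Qed.

(** Squaring and expanding leaves [2 <x - y, v> <= t <v, v>]. Only the segment from [y] in direction
    [v] enters, so no convex set is mentioned. *)
Lemma wproj_variational (R : realType) (J : finType) (w : J -> R) (x y v : J -> R) :
  (forall j, 0 < w j) ->
  (forall t, 0 < t -> t <= 1 -> wnorm w (x - y) <= wnorm w (x - (y + t *: v))) ->
  wip w (x - y) v <= 0.
Proof.
move=> w0 h; suff : 2 * wip w (x - y) v <= 0 by lra.
apply: (@le0_small _ _ (wip w v v)) => t t0 t1.
have := h t t0 t1; rewrite /wnorm ler_sqrt ?wip_ge0//.
have -> : x - (y + t *: v) = (x - y) - t *: v by rewrite opprD addrA.
move: (x - y) => a; rewrite !wipE (wipC w v a) => h'.
rewrite -(ler_pM2l t0); lra.
Qed.

End Projection.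

(** * Lagrangian minimisers and first-order dual optimality *)

Section DualFunction.
Local Open Scope classical_set_scope.
Local Open Scope ring_scope.
Variables (R : realType) (I J : finType).
(** Equality and inequality rows share the index [J]; [nonneg] marks those whose multiplier is sign
    constrained. *)
Variables (G : J -> I -> R) (g : J -> R) (nonneg : pred J).
Variables (f : (I -> R) -> R) (gr : (I -> R) -> I -> R) (s L : R).
Hypothesis s0 : 0 < s.
Hypothesis f_strong : forall x y : I -> R,
  f x + ip (gr x) (y - x) + s / 2 * ip (y - x) (y - x) <= f y.
Hypothesis gr_lip : forall x y, norm (gr x - gr y) <= L * norm (x - y).
Implicit Types (x y z p : I -> R) (l v u : J -> R).

Let one_gt0 (T : finType) (j : T) : 0 < (1 : R). Proof. exact: ltr01. Qed.

Definition lin z : J -> R := fun j => \sum_i G j i * z i.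
Definition adj v : I -> R := fun i => \sum_j G j i * v j.
Definition res z : J -> R := lin z - g.
Definition lag z l := f z + ip l (res z).
Definition lag_min l z := forall z', lag z l <= lag z' l.
Definition dual_feasible l := forall j, nonneg j -> 0 <= l j.
(** Carrying the minimiser [z] makes [lag z l] the dual value, so the dual function itself need not
    be defined. *)
Definition dual_opt l z := [/\ dual_feasible l, lag_min l z &
  forall l' z', dual_feasible l' -> lag_min l' z' -> lag z' l' <= lag z l].

Lemma adjoint v z : ip v (lin z) = ip (adj v) z.
Proof.
transitivity (\sum_j \sum_i G j i * v j * z i).
  apply: eq_bigr => j _; rewrite mul1r /lin mulr_sumr; apply: eq_bigr => i _.
  by rewrite mulrA [v j * _]mulrC.
by rewrite exchange_big; apply: eq_bigr => i _; rewrite mul1r /adj mulr_suml.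
Qed.

Lemma linB z z' : lin (z - z') = lin z - lin z'.
Proof.
apply/funext => j; rewrite -[RHS]/(lin z j - lin z' j) /lin -sumrB; apply: eq_bigr => i _.
by rewrite mulrBr.
Qed.

Lemma adjD v v' : adj (v + v') = adj v + adj v'.
Proof.
apply/funext => i; rewrite -[RHS]/(adj v i + adj v' i) /adj -big_split.
by apply: eq_bigr => j _ /=; rewrite -mulrDr.
Qed.

Lemma adjZ a v : adj (a *: v) = a *: adj v.
Proof.
apply/funext => i; rewrite -[RHS]/(a * adj v i) /adj mulr_sumr.
by apply: eq_bigr => j _; rewrite -[(a *: v) j]/(a * v j) mulrCA.
Qed.

Lemma adjN v : adj (- v) = - adj v.
Proof. by rewrite -scaleN1r adjZ scaleN1r. Qed.

Lemma adjB v v' : adj (v - v') = adj v - adj v'.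
Proof. by rewrite adjD adjN. Qed.

Lemma resB z z' : res z - res z' = lin (z - z').
Proof. by rewrite linB /res opprB addrA subrK. Qed.

Lemma lag_strong l x y :
  lag x l + ip (gr x + adj l) (y - x) + s / 2 * ip (y - x) (y - x) <= lag y l.
Proof.
have := f_strong x y; rewrite /lag.
have -> : ip l (res y) = ip l (res x) + ip (adj l) (y - x).
  by rewrite -adjoint -resB -wipDr addrC subrK.
rewrite (wipDl _ (gr x)); lra.
Qed.

Lemma gr_mono x y : s * ip (x - y) (x - y) <= ip (gr x - gr y) (x - y).
Proof.
have := f_strong x y; have := f_strong y x.
rewrite -(opprB x y) !(wipNr, wipNl) (wipBl _ (gr x)) opprK; lra.
Qed.

(** Here [gr] is known only through [f_strong] and [gr_lip], so stationarity is derived from these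
    two inequalities. *)
Lemma lag_min_grad l z : lag_min l z -> gr z = - adj l.
Proof.
move=> zmin; apply/eqP; rewrite -addr_eq0; apply/eqP.
(* Compare [z] with the gradient step [z - t p]. *)
set p := gr z + adj l; apply: (wip_eq0 (w := fun=> 1)) => //.
apply/eqP; rewrite eq_le wip_ge0// andbT.
apply: (@le0_small _ _ (L * ip p p)) => t t0 _.
pose y := z - t *: p.
have yz : z - y = t *: p by rewrite /y opprB addrC subrK.
have h1 : lag y l + ip (gr y + adj l) (z - y) <= lag z l.
  apply: le_trans (lag_strong l y z); rewrite lerDl mulr_ge0 ?wip_ge0//.
  by rewrite divr_ge0// ltW.
have h2 : ip (gr z - gr y) (z - y) <= L * ip (z - y) (z - y).
  apply: le_trans (wip_le _ _ _) _ => //.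
  by rewrite -wnormE// expr2 mulrA ler_wpM2r ?wnorm_ge0// gr_lip.
have e : gr y + adj l = p - (gr z - gr y).
  by rewrite opprB addrCA /p [gr z + _]addrC addrK.
have h3 := zmin y.
move: h1; rewrite e wipBl => h1.
have : t * ip p p <= t * (t * (L * ip p p)).
  have -> : t * ip p p = ip p (z - y) by rewrite yz wipZr.
  have -> : t * (t * (L * ip p p)) = L * ip (z - y) (z - y).
    by rewrite yz wipZl wipZr; ring.
  lra.
by rewrite ler_pM2l.
Qed.

(** By stationarity the gradients differ by [adj (l - l')] up to sign; strong monotonicity and
    Cauchy-Schwarz conclude. *)
Lemma lag_min_close l l' z z' : lag_min l z -> lag_min l' z' ->
  s * norm (z - z') <= norm (adj (l - l')).
Proof.
move=> /lag_min_grad gz /lag_min_grad gz'.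
have [->|n0] := eqVneq (norm (z - z')) 0; first by rewrite mulr0 wnorm_ge0.
have np : 0 < norm (z - z') by rewrite lt_def n0 wnorm_ge0.
rewrite -(ler_pM2r np) -mulrA -expr2 wnormE//.
apply: le_trans (gr_mono z z') _; apply: le_trans (wip_le _ _ _) _ => //.
by rewrite gz gz' opprK addrC -adjB -(opprB l l') adjN wnormN.
Qed.

Local Notation V := (prod_topology (fun _ : I => R)).

(** Around [x], [f] is squeezed between its tangent [lo] and the tangent plus a quadratic term,
    [hi]; the upper bound uses [f_strong] at [y] and the Lipschitz gradient. *)
Lemma f_continuous : continuous (f : V -> R).
Proof.
move=> x.
pose lo (y : V) := f x + ip (gr x) ((y : I -> R) - x).
pose hi (y : V) := lo y + L * ip ((y : I -> R) - x) ((y : I -> R) - x).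
have dc i : continuous (fun y : V => (y i - x i : R)).
  exact: (subf_continuous (@coordinate_continuous R I i) (@const_continuous R I (x i))).
have loc : continuous lo.
  apply: (addf_continuous (@const_continuous R I (f x))).
  exact: (wip_continuous (f := fun i _ => gr x i) (g := fun i y => y i - x i)
    (fun i => @const_continuous R I (gr x i)) dc).
have hic : continuous hi.
  apply: (addf_continuous loc).
  exact: (mul_continuous (@const_continuous R I L)
    (wip_continuous (f := fun i y => y i - x i) (g := fun i y => y i - x i) dc dc)).
have lox : lo x = f x by rewrite /lo subrr wipC wip0l addr0.
have hix : hi x = f x by rewrite /hi lox subrr wip0l mulr0 addr0.
have bnd y : lo y <= f y <= hi y.
  apply/andP; split.
    apply: le_trans (f_strong x y); rewrite lerDl mulr_ge0 ?wip_ge0//.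
    by rewrite divr_ge0// ltW.
  have h1 : f y + ip (gr y) (x - y) <= f x.
    apply: le_trans (f_strong y x); rewrite lerDl mulr_ge0 ?wip_ge0//.
    by rewrite divr_ge0// ltW.
  have h2 : ip (gr y - gr x) (y - x) <= L * ip (y - x) (y - x).
    apply: le_trans (wip_le _ _ _) _ => //.
    by rewrite -wnormE// expr2 mulrA ler_wpM2r ?wnorm_ge0// gr_lip.
  move: h1 h2; rewrite /hi /lo -(opprB y x) wipNr (wipBl _ (gr y)); lra.
have nb : \forall y \near nbhs x, lo y <= f y <= hi y by apply: nearW.
have lol : lo @ x --> f x by rewrite -lox; exact: loc.
have hil : hi @ x --> f x by rewrite -hix; exact: hic.
exact (squeeze_cvgr nb lol hil).
Qed.

(** Strong convexity bounds the Lagrangian below by its value at 0 plus the coercive quadratic [q].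
    Outside the compact set where [q] is at most 0 it exceeds its value at 0, so a minimiser on that
    set is global. *)
Lemma lag_min_exists l : exists z, lag_min l z.
Proof.
pose p := gr 0 + adj l.
pose q (y : V) : R := s / 2 * ip (y : I -> R) y + ip p y.
have cc := @coordinate_continuous R I.
have ipc (v : I -> R) : continuous (fun y : V => ip v y).
  exact: (wip_continuous (f := fun i _ => v i) (g := fun i y => y i)
    (fun i => @const_continuous R I (v i)) cc).
have qc : continuous q.
  apply: addf_continuous (ipc p).
  exact: (mul_continuous (@const_continuous R I (s / 2))
    (wip_continuous (f := fun i y => y i) (g := fun i y => y i) cc cc)).
have lagc : continuous (fun y : V => lag y l).
  have -> : (fun y : V => lag y l) =
      (fun y : V => f y + (ip (adj l) (y : I -> R) - ip l g)).
    by apply/funext => y; rewrite /lag /res wipBr adjoint.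
  apply: (addf_continuous f_continuous).
  exact: (subf_continuous (ipc _) (@const_continuous R I (ip l g))).
have low y : lag 0 l + q y <= lag y l.
  by have := lag_strong l 0 y; rewrite subr0 /q -/p; lra.
have q0 : q 0 <= 0 by rewrite /q wip0l wipC wip0l mulr0 addr0.
have qb (y : V) : q y <= 0 -> forall i, `|y i| <= 2 / s * norm p.
  move=> qy i.
  have ni : `|y i| <= norm y.
    rewrite -ler_sqr ?nnegrE ?wnorm_ge0// real_normK ?num_real// wnormE//.
    rewrite /wip (bigD1 i)//= mul1r expr2 lerDl sumr_ge0// => j _.
    by rewrite mul1r -expr2 sqr_ge0.
  apply: le_trans ni _.
  have h : s / 2 * norm y ^+ 2 <= norm p * norm y.
    rewrite wnormE//; have := @wip_le _ _ (fun=> 1) (- p) y (@one_gt0 I).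
    by move: qy; rewrite /q wnormN wipNl; lra.
  have [->|n0] := eqVneq (norm y) 0.
    by rewrite mulr_ge0 ?wnorm_ge0// divr_ge0// ltW.
  have np : 0 < norm y by rewrite lt_def n0 wnorm_ge0.
  move: h; rewrite expr2 mulrA ler_pM2r// => h.
  rewrite -invf_div ler_pdivlMl// divr_gt0//.
have [c _ cmin] := compact_box_min (closed_le0 qc) qb (ex_intro _ 0 q0) lagc.
exists c => z; have [qz|qz] := leP (q z) 0; first exact: cmin.
by apply: le_trans (cmin 0 q0) _; apply: le_trans (low z); rewrite lerDl ltW.
Qed.

Lemma dual_opt_variational l z (y : J -> R) : dual_opt l z -> dual_feasible y ->
  ip (res z) (y - l) <= 0.
Proof.
move=> [lD zmin zmax] yD; set v := y - l.
(* Maximality bounds the slope at the minimiser [zt] of the Lagrangian at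
   [l + t v], and [zt] is within O(t) of [z]. *)
apply: (@le0_small _ _ (norm (adj v) ^+ 2 / s)) => t t0 t1.
have ltD : dual_feasible (l + t *: v).
  move=> j jn; have := lD j jn; have := yD j jn.
  change (0 <= y j -> 0 <= l j -> 0 <= l j + t * (y j - l j)) => yj lj.
  have -> : l j + t * (y j - l j) = (1 - t) * l j + t * y j by ring.
  by rewrite addr_ge0// mulr_ge0// ?subr_ge0// ltW.
have [zt ztmin] := lag_min_exists (l + t *: v).
(* Maximality of [l], then minimality of [z]: the two Lagrangian values at [zt] differ by
   [t <res zt, v>]. *)
have h1 := le_trans (zmax _ _ ltD ztmin) (zmin zt).
have h2 : ip (res zt) v <= 0.
  rewrite wipC -(pmulr_rle0 _ t0); move: h1; rewrite /lag wipDl wipZl; lra.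
have -> : ip (res z) v = ip (res zt) v + ip (adj v) (z - zt).
  by rewrite -adjoint -resB wipBr !(wipC _ v) addrC subrK.
have h3 : ip (adj v) (z - zt) <= norm (adj v) * norm (z - zt) by exact: wip_le.
have h4 : s * norm (z - zt) <= t * norm (adj v).
  apply: le_trans (lag_min_close zmin ztmin) _.
  rewrite opprD addrA subrr add0r adjN wnormN adjZ.
  rewrite /wnorm wipZl wipZr mulrA -expr2 sqrtrM ?sqr_ge0//.
  by rewrite sqrtr_sqr ger0_norm// ltW.
have : norm (adj v) * norm (z - zt) <= t * (norm (adj v) ^+ 2 / s).
  rewrite mulrA ler_pdivlMr//.
  by have := ler_wpM2l (wnorm_ge0 (fun=> 1) (adj v)) h4; lra.
lra.
Qed.

(** Adding the two variational inequalities contradicts strong monotonicity unless [z = z']; they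
    then bound the same slope from both sides. *)
Lemma dual_opt_unique l z l' z' : dual_opt l z -> dual_opt l' z' ->
  z = z' /\ ip (res z) (l - l') = 0.
Proof.
move=> o o'; have [lD zm _] := o; have [lD' zm' _] := o'.
have h1 := dual_opt_variational o lD'; have h2 := dual_opt_variational o' lD.
have zz : z = z'.
  apply/eqP; rewrite -subr_eq0; apply/eqP; apply: (wip_eq0 (w := fun=> 1)) => //.
  apply/eqP; rewrite eq_le wip_ge0// andbT -(pmulr_rle0 _ s0).
  apply: le_trans (gr_mono z z') _.
  rewrite (lag_min_grad zm) (lag_min_grad zm') opprK addrC -adjB -adjoint -resB.
  move: h1 h2; rewrite -(opprB l l') !(wipNr, wipNl) (wipC _ (l - l')) wipBl; lra.
subst z'; split=> //; apply/eqP; rewrite eq_le h2.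
by move: h1; rewrite -(opprB l l') wipNr oppr_le0 => ->.
Qed.

(** The two equations on [k] make [ip k (res z')] vanish for every [z'], so the Lagrangian does not
    change at all. *)
Lemma dual_opt_shift l z k : dual_opt l z -> dual_feasible (l - k) ->
  adj k = 0 -> ip (res z) k = 0 -> dual_opt (l - k) z.
Proof.
move=> [lD zm zmax] kD ak rk.
have e z' : lag z' (l - k) = lag z' l.
  rewrite /lag wipBl (_ : ip k _ = 0) ?subr0//.
  by rewrite -(subrK (res z) (res z')) resB wipDr adjoint ak wip0l add0r wipC.
split=> // [z'|l' z' l'D z'm]; first by rewrite !e.
by rewrite e; exact: zmax.
Qed.

Variable w : J -> R.
Hypothesis w0 : forall j, 0 < w j.

(** Cauchy-Schwarz in the weighted product, after writing [ip v u] as the weighted product of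
    [W^-1 v] and [u]. *)
Lemma ip_wnorm_bound v : exists2 D, 0 < D & forall u, ip v u <= D * wnorm w u.
Proof.
exists (1 + wnorm w (fun j => v j / w j)).
  by rewrite ltr_pwDl// wnorm_ge0.
move=> u; have -> : ip v u = wip w (fun j => v j / w j) u.
  by apply: eq_bigr => j _; have := w0 j => wj; field; rewrite gt_eqF.
apply: le_trans (wip_le _ _ w0) _.
by rewrite ler_wpM2r ?wnorm_ge0// lerDr.
Qed.

Lemma adj_bound : exists2 K, 0 < K & forall v, norm (adj v) <= K * wnorm w v.
Proof.
have [K K0 hK] : exists2 K, 0 < K & forall i, forall v, `|adj v i| <= K * wnorm w v.
  apply: uniform_upper_bound => i.
  have [D D0 hD] := ip_wnorm_bound (G ^~ i).
  exists D; split=> // E DE v; apply: (@le_trans _ _ (D * wnorm w v)); last first.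
    by rewrite ler_wpM2r ?wnorm_ge0.
  have e u : adj u i = ip (G ^~ i) u by apply: eq_bigr => j _; rewrite mul1r.
  rewrite ler_norml -lerN2 opprK -[- adj v i]/((- adj v) i) -adjN !e hD andbT.
  by rewrite -(wnormN w v) hD.
exists (Num.sqrt (1 + #|I|%:R) * K); first by rewrite mulr_gt0// sqrtr_gt0 ltr_pwDl.
move=> v; rewrite -ler_sqr ?nnegrE ?mulr_ge0 ?wnorm_ge0 ?sqrtr_ge0 ?(ltW K0)//.
rewrite wnormE// -mulrA exprMn sqr_sqrtr ?addr_ge0//.
apply: (@le_trans _ _ (\sum_(i : I) (K * wnorm w v) ^+ 2)).
  apply: ler_sum => i _; rewrite mul1r -expr2 -real_normK ?num_real//.
  by rewrite ler_sqr ?nnegrE ?mulr_ge0 ?wnorm_ge0 ?(ltW K0).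
by rewrite sumr_const -[leLHS]mulr_natl ler_wpM2r ?sqr_ge0// lerDr.
Qed.

End DualFunction.

(** * The error bound for unstructured data *)

Section QuadraticInequality.
Local Open Scope ring_scope.

(** The larger root of [a^2 = b a + c^2] is at most [b + c]. *)
Lemma le_of_sqr_le (R : realFieldType) (a b c : R) :
  0 <= b -> 0 <= c -> a ^+ 2 <= b * a + c ^+ 2 -> a <= b + c.
Proof. by move=> b0 c0 h; rewrite leNgt; apply/negP => h2; nra. Qed.

End QuadraticInequality.

Section FlatErrorBound.
Local Open Scope classical_set_scope.
Local Open Scope ring_scope.
Variables (R : realType) (I J : finType).
Variables (G : J -> I -> R) (g : J -> R) (nonneg : pred J).
Variables (f : (I -> R) -> R) (gr : (I -> R) -> I -> R) (s L : R).
Hypothesis s0 : 0 < s.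
Hypothesis f_strong : forall x y : I -> R,
  f x + ip (gr x) (y - x) + s / 2 * ip (y - x) (y - x) <= f y.
Hypothesis gr_lip : forall x y, norm (gr x - gr y) <= L * norm (x - y).
Variable w : J -> R.
Hypothesis w0 : forall j, 0 < w j.

Let one_gt0 (T : finType) (j : T) : 0 < (1 : R). Proof. exact: ltr01. Qed.

Local Notation adj := (adj G).
Local Notation res := (res G g).
Local Notation lag_min := (lag_min G g f).
Local Notation dual_opt := (dual_opt G g nonneg f).
Local Notation dual_feasible := (dual_feasible nonneg).

Lemma dist_opt_le_residual l0 z0 : dual_opt l0 z0 ->
  exists2 H, 0 < H & forall l lbar z', dual_feasible l -> dual_opt lbar z' ->
    (forall l1 z1, dual_opt l1 z1 -> wnorm w (l - lbar) <= wnorm w (l - l1)) ->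
    wip w (lbar - l) (lbar - l) <=
      H * (norm (adj (lbar - l)) ^+ 2 + ip (res z0) (lbar - l) ^+ 2).
Proof.
move=> o0.
(* The linear forms cutting out the optimal set: the columns of [G], and the residual [res z0] as
   one extra row. *)
pose B (o : option I) : J -> R := if o is Some i then G ^~ i else res z0.
have [H H0 hH] := hoffman_conformal w0 B.
have Badj i v : ip (B (Some i)) v = adj v i by apply: eq_bigr => j _; rewrite mul1r.
exists H => // l lbar z' lD obar proj.
have [ez _] := dual_opt_unique s0 f_strong gr_lip o0 obar; subst z'.
have -> : norm (adj (lbar - l)) ^+ 2 + ip (res z0) (lbar - l) ^+ 2 =
    \sum_o ip (B o) (lbar - l) ^+ 2.
  rewrite wnormE// (bigD1 None)//= addrC; congr (_ + _).
  rewrite (reindex_omap Some id) => [|[i|]]//=.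
  rewrite [LHS](eq_bigl (fun i => true && (Some i == Some i)));
    last by move=> i; rewrite eqxx.
  by apply: eq_bigr => i _; rewrite mul1r Badj expr2.
apply: hH => k kB cf; apply/eqP/negPn/negP => kN0.
have [t t0 [lt_t bd]] := shrink_conformal w0 kN0 cf.
have ak : adj (t *: k) = 0.
  by rewrite adjZ; apply/funext => i; rewrite -[LHS]/(t * adj k i) -Badj kB mulr0.
have rk : ip (res z0) (t *: k) = 0 by rewrite wipZr (kB None) mulr0.
have [lbD _ _] := obar.
(* Each coordinate of the moved point lies between those of [lbar] and [l]. *)
have lkD : dual_feasible (lbar - t *: k).
  move=> j jn; have := lD j jn; have := lbD j jn; have := bd j.
  change (0 <= t * k j <= lbar j - l j \/ lbar j - l j <= t * k j <= 0 ->
    0 <= lbar j -> 0 <= l j -> 0 <= lbar j - t * k j).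
  by move: (t * k j) => a [] /andP[]; lra.
have := proj _ _ (dual_opt_shift obar lkD ak rk).
rewrite leNgt => /negP; apply.
rewrite (wnormB w l lbar) (_ : l - (lbar - t *: k) = - (lbar - l - t *: k));
  last by rewrite !opprB addrCA.
by rewrite wnormN /wnorm ltr_sqrt// (le_lt_trans _ lt_t)// wip_ge0.
Qed.

Lemma flat_error_bound : exists2 C, 0 < C &
  forall l z, dual_feasible l -> lag_min l z ->
  forall prx, dual_feasible prx ->
    (forall y, dual_feasible y ->
      wnorm w (l + (fun j => res z j / w j) - prx) <=
      wnorm w (l + (fun j => res z j / w j) - y)) ->
  forall lbar zbar, dual_opt lbar zbar ->
    (forall l1 z1, dual_opt l1 z1 -> wnorm w (l - lbar) <= wnorm w (l - l1)) ->
  wnorm w (l - lbar) <= C * (1 + wnorm w (l - lbar)) * wnorm w (prx - l).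
Proof.
have [[[l0 z0] /= o0]|no] := pselect (exists lz, dual_opt lz.1 lz.2); last first.
  by exists 1 => // l z _ _ prx _ _ lbar zbar o; case: no; exists (lbar, zbar).
have [H H0 hH] := dist_opt_le_residual o0.
have [D D0 hD] := ip_wnorm_bound w0 (res z0).
have [K K0 hK] := adj_bound G w0.
(* With [a] and [e] the weighted norms of [u] and [r], [C3] will satisfy [<p, dl> <= C3 e a], and
   [C1 = L^2 / s * C3] will satisfy [|p|^2 <= C1 e a]. *)
pose C1 := L ^+ 2 / s * (K ^+ 2 / s + 1).
pose C3 := K ^+ 2 / s + 1.
have C30 : 0 < C3 by rewrite ltr_wpDl// divr_ge0 ?sqr_ge0// ltW.
have C10 : 0 <= C1 by rewrite mulr_ge0 ?(ltW C30)// divr_ge0 ?sqr_ge0// ltW.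
exists (H * C1 + (1 + H) * D + (1 + H) * C3).
  have H10 : 0 < 1 + H by lra.
  by apply: addr_gt0; rewrite ?mulr_gt0// ltr_wpDl ?mulr_gt0// mulr_ge0// ltW.
move=> l z lD zm prx prxD prxm lbar zbar ob proj.
have hof := hH _ _ _ lD ob proj.
have [ez _] := dual_opt_unique s0 f_strong gr_lip o0 ob; subst zbar.
have [lbD z0m _] := ob.
set u := lbar - l in hof *; set r := prx - l.
rewrite wnormB -/u; set a := wnorm w u; set e := wnorm w r.
set dl := z - z0; pose p := adj u.
have a0 : 0 <= a by exact: wnorm_ge0.
have e0 : 0 <= e by exact: wnorm_ge0.
have d0 : 0 <= norm dl by exact: wnorm_ge0.
(* Projection inequality for [prx] tested at [lbar]; the weights cancel against [W^-1]. *)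
have VI : ip (res z) (u - r) <= wip w r (u - r).
  have -> : u - r = lbar - prx by rewrite /u /r opprB addrA subrK.
  have := @wproj_variational R J w (l + (fun j => res z j / w j)) prx (lbar - prx) w0.
  have -> : l + (fun j => res z j / w j) - prx = (fun j => res z j / w j) - r.
    by rewrite /r opprB addrAC addrC.
  have rw v : wip w (fun j => res z j / w j) v = ip (res z) v.
    by apply: eq_bigr => j _; have := w0 j => wj; field; rewrite gt_eqF.
  rewrite (wipBl _ _ r) rw subr_le0; apply => t t0 t1.
  have -> : (fun j => res z j / w j) - r = l + (fun j => res z j / w j) - prx.
    by rewrite /r opprB addrAC addrC.
  apply: prxm => j jn; have := prxD j jn; have := lbD j jn.
  change (0 <= lbar j -> 0 <= prx j -> 0 <= prx j + t * (lbar j - prx j)) => h1 h2.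
  have -> : prx j + t * (lbar j - prx j) = (1 - t) * prx j + t * lbar j by ring.
  by rewrite addr_ge0// mulr_ge0// ?subr_ge0// ltW.
have opt1 : ip (res z0) (r - u) <= 0.
  have -> : r - u = prx - lbar by rewrite /u /r opprB addrA subrK.
  exact: (dual_opt_variational s0 f_strong gr_lip ob prxD).
have opt2 : 0 <= ip (res z0) u.
  rewrite -oppr_le0 -wipNr opprB.
  exact: (dual_opt_variational s0 f_strong gr_lip ob lD).
have resz v : ip (res z) v = ip (res z0) v + ip (adj v) dl.
  by rewrite -adjoint -(resB G g) wipBr !(wipC _ v) addrC subrK.
have pE : p = gr z - gr z0.
  rewrite /p /u adjB (lag_min_grad s0 f_strong gr_lip zm).
  by rewrite (lag_min_grad s0 f_strong gr_lip z0m) opprK addrC.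
have pL : norm p <= L * norm dl by rewrite pE gr_lip.
have pK : norm p <= K * a by exact: hK.
have mono : s * norm dl ^+ 2 <= ip p dl.
  by rewrite wnormE// pE; exact: (gr_mono f_strong).
have pd : ip p dl <= norm p * norm dl by exact: wip_le.
have rd : ip (adj r) dl <= K * e * norm dl.
  by apply: le_trans (wip_le _ _ (@one_gt0 I)) _; rewrite ler_wpM2r.
have ru : wip w r u <= e * a by exact: wip_le.
have rr : 0 <= wip w r r by exact: wip_ge0.
have Dr : ip (res z0) r <= D * e by exact: hD.
have dK : norm dl <= K / s * a.
  have [->|n0] := eqVneq (norm dl) 0.
    by rewrite mulr_ge0// divr_ge0// ltW.
  have np : 0 < norm dl by rewrite lt_def n0.
  rewrite mulrAC ler_pdivlMr// mulrC -(ler_pM2r np) -mulrA -expr2.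
  by apply: le_trans mono _; apply: le_trans pd _; rewrite ler_pM2r.
move: VI opt1; rewrite !(wipBr _ u r) (wipBr _ r u) !resz -/p => VI opt1.
have ed : K * e * norm dl <= K ^+ 2 / s * (e * a).
  have -> : K ^+ 2 / s * (e * a) = K * e * (K / s * a) by ring.
  by rewrite ler_wpM2l// mulr_ge0// ltW.
have C3E : C3 * (e * a) = K ^+ 2 / s * (e * a) + e * a by rewrite /C3 mulrDl mul1r.
(* Sum of [VI] and [opt1]: the terms in [res z0] cancel and [- <r, r>] is dropped. *)
have pea : ip p dl <= C3 * (e * a) by lra.
have p2 : norm p ^+ 2 <= C1 * e * a.
  apply: (@le_trans _ _ ((L * norm dl) ^+ 2)).
    by rewrite ler_sqr ?nnegrE ?(le_trans _ pL) ?wnorm_ge0.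
  have -> : C1 * e * a = L ^+ 2 / s * (C3 * (e * a)) by rewrite /C1 /C3; ring.
  rewrite exprMn -mulrA ler_wpM2l ?sqr_ge0// ler_pdivlMl//; lra.
have sdl : 0 <= s * norm dl ^+ 2 by rewrite mulr_ge0 ?sqr_ge0// ltW.
(* [VI] alone, now dropping the nonnegative [<p, dl>] instead. *)
have q1 : ip (res z0) u <= e * (D + C3 * a) by rewrite mulrDr; lra.
have q2 : ip (res z0) u ^+ 2 <= (e * (D + C3 * a)) ^+ 2.
  by rewrite ler_sqr ?nnegrE// (le_trans opt2).
have q0 : 0 <= e * (D + C3 * a) by exact: le_trans q1.
(* Enlarging [H] to [(1 + H)^2] makes the last term a square, as [le_of_sqr_le] requires. *)
have main : a ^+ 2 <= H * C1 * e * a + ((1 + H) * (e * (D + C3 * a))) ^+ 2.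
  rewrite wnormE//; apply: le_trans hof _; rewrite mulrDr.
  apply: lerD.
    by rewrite -!mulrA ler_pM2l// !mulrA.
  rewrite exprMn; apply: ler_pM => //; rewrite ?sqr_ge0 ?(ltW H0)//.
  by nra.
have H1 : 0 <= 1 + H by rewrite addr_ge0// ltW.
have h1 : 0 <= H * C1 by rewrite mulr_ge0// ltW.
have h2 : 0 <= (1 + H) * D by rewrite mulr_ge0// ltW.
have h3 : 0 <= (1 + H) * C3 by rewrite mulr_ge0// ltW.
apply: le_trans (le_of_sqr_le (mulr_ge0 h1 e0) (mulr_ge0 H1 q0) main) _.
rewrite -subr_ge0.
set X := (X in 0 <= X).
have -> : X = H * C1 * (e * a) + (1 + H) * D * (e * a) + (1 + H) * C3 * e
  by rewrite /X; ring.
by apply: addr_ge0; [apply: addr_ge0|]; apply: mulr_ge0 => //; exact: mulr_ge0.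
Qed.

End FlatErrorBound.

(** * Reduction of the block-structured problem *)

Section StrongConvexity.
Local Open Scope ring_scope.

Lemma strong_convexity_gradient (R : realType) (J : finType) (s : R)
    (f : (J -> R) -> R) (x y p : J -> R) :
  (forall e : R, 0 < e -> exists2 d : R, 0 < d & forall h,
    norm h < d -> `|f (x + h) - f x - ip p h| <= e * norm h) ->
  (forall t : R, 0 <= t <= 1 -> f (t *: y + (1 - t) *: x) <=
    t * f y + (1 - t) * f x - s / 2 * t * (1 - t) * norm (y - x) ^+ 2) ->
  0 <= s -> f x + ip p (y - x) + s / 2 * ip (y - x) (y - x) <= f y.
Proof.
move=> fgrad fconv s0; set v := y - x.
have n0 : 0 <= norm v by exact: wnorm_ge0.
rewrite -(@wnormE _ _ (fun=> 1) v (fun=> ltr01)) -subr_le0.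
apply: (@le0_small _ _ (norm v + s / 2 * norm v ^+ 2)) => e e0 e1.
have [d d0 fd] := fgrad _ e0.
(* Small enough for the expansion at [x] to apply and for the quadratic error to be of order [e];
   the 1 avoids dividing by 0. *)
pose t := Num.min e (d / (norm v + 1)).
have t0 : 0 < t by rewrite lt_min e0 divr_gt0// ltr_wpDl.
have te : t <= e by rewrite ge_min lexx.
have td : t * norm v < d.
  have : t * (norm v + 1) <= d by rewrite -ler_pdivlMr ?ltr_wpDl// ge_min lexx orbT.
  by apply: lt_le_trans; rewrite mulrDr mulr1 ltrDl.
have nt : norm (t *: v) = t * norm v.
  rewrite /wnorm wipZl wipZr mulrA -expr2 sqrtrM ?sqr_ge0// sqrtr_sqr.
  by rewrite ger0_norm// ltW.
have := fd (t *: v); rewrite nt => /(_ td); rewrite ler_norml => /andP[h1 _].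
have := fconv t; rewrite (ltW t0) (le_trans te e1) => /(_ isT).
have -> : t *: y + (1 - t) *: x = x + t *: v.
  by rewrite scalerBl scale1r /v scalerBr addrCA.
rewrite -/v => h2; move: h1; rewrite wipZr => h1.
have tn : t * (s / 2 * norm v ^+ 2) <= e * (s / 2 * norm v ^+ 2).
  by rewrite ler_wpM2r// mulr_ge0 ?sqr_ge0// divr_ge0.
suff : t * (f x + ip p v + s / 2 * norm v ^+ 2 - f y) <=
    t * (e * norm v + t * (s / 2 * norm v ^+ 2)).
  by rewrite ler_pM2l//; move: tn; lra.
lra.
Qed.

End StrongConvexity.

(** * Flattening of block variables and multipliers *)

Section Flatten.
Local Open Scope ring_scope.
Variable P : problem.
Local Notation R := Rdefinitions.R.

Definition pidx := {i : 'I_(M P) & 'I_(nb P i)}.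
Definition didx := {j : 'I_(Mb P) & ('I_(pb P j) + 'I_(qb P j))%type}.

Definition pflat (z : pvar P) : pidx -> R := fun x => z (tag x) (tagged x).
Definition punflat (y : pidx -> R) : pvar P := fun i k => y (Tagged _ k).
Definition dflat (l : dvar P) : didx -> R := fun x =>
  match tagged x with inl k => l.1 (tag x) k | inr k => l.2 (tag x) k end.
Definition dunflat (v : didx -> R) : dvar P :=
  (fun j k => v (existT _ j (inl k)), fun j k => v (existT _ j (inr k))).

Definition Gflat (x : didx) (y : pidx) : R :=
  match tagged x with
  | inl k => Ab P (tag x) (tag y) k (tagged y)
  | inr k => Cb P (tag x) (tag y) k (tagged y)
  end.
Definition gflat : didx -> R := dflat (bb P, cb P).
Definition ineq_row : pred didx := fun x => if tagged x is inr _ then true else false.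
Definition fflat (y : pidx -> R) : R := fsum P (punflat y).

Lemma punflatK : cancel punflat pflat.
Proof. by move=> y; apply/funext => -[i k]. Qed.

Lemma dunflatK : cancel dunflat dflat.
Proof. by move=> v; apply/funext => -[j [k|k]]. Qed.

Lemma sum_pidx (F : pidx -> R) :
  \sum_x F x = \sum_(i < M P) \sum_(k < nb P i) F (existT _ i k).
Proof. by rewrite sig_big_dep; apply: eq_bigr => -[i k]. Qed.

Lemma sum_didx (F : didx -> R) : \sum_x F x =
  \sum_(j < Mb P) (\sum_(k < pb P j) F (existT _ j (inl k)) +
                    \sum_(k < qb P j) F (existT _ j (inr k))).
Proof.
transitivity (\sum_(j < Mb P) \sum_(u : 'I_(pb P j) + 'I_(qb P j)) F (existT _ j u)).
  by rewrite sig_big_dep; apply: eq_bigr => -[j u].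
by apply: eq_bigr => j _; rewrite big_sumType.
Qed.

Lemma dotE n (x y : vec n) : dot x y = ip x y.
Proof. by apply: eq_bigr => k _; rewrite mul1r. Qed.

Lemma norm2E n (x : vec n) : norm2 x = norm x.
Proof. by rewrite /norm2 RsqrtE dotE. Qed.

Lemma dflat_dadd l l' : dflat (dadd P l l') = dflat l + dflat l'.
Proof. by apply/funext => -[j [k|k]]. Qed.

Lemma dflat_dsub l l' : dflat (dsub P l l') = dflat l - dflat l'.
Proof. by apply/funext => -[j [k|k]]. Qed.

Lemma dflat_res z : dflat (resA P z, resC P z) = res Gflat gflat (pflat z).
Proof.
by apply/funext => -[j [k|k]]; apply: (f_equal (fun a : R => a - _));
  rewrite /lin sum_pidx.
Qed.

Lemma LagrE z l : Lagr P z l = lag Gflat gflat fflat (pflat z) (dflat l).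
Proof.
rewrite /Lagr /lag -dflat_res RplusE RplusE -addrA; congr (_ + _).
rewrite /wip sum_didx big_split; congr (_ + _); apply: eq_bigr => j _;
  by rewrite dotE.
Qed.

Lemma lagr_minE l z :
  is_lagr_min P l z <-> lag_min Gflat gflat fflat (dflat l) (pflat z).
Proof.
split=> h z'.
  by rewrite -(punflatK z') -!LagrE; apply/RleP; exact: h.
by apply/RleP; rewrite !LagrE.
Qed.

Lemma inDE l : inD P l <-> dual_feasible ineq_row (dflat l).
Proof.
split=> [lD [j [//|k]] _|lD j k]; first by apply/RleP; exact: lD.
by apply/RleP; exact: (lD (existT _ j (inr k))).
Qed.

(** An attained lower bound of the Lagrangian is its value at a minimiser, so quantifying over dual
    values or over minimisers is the same. *)
Lemma LstarE l : Lstar P l <->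
  exists z, dual_opt Gflat gflat ineq_row fflat (dflat l) z.
Proof.
split=> [[lD [v [[[z zv] vmin] vmax]]]|[z [lD zm zmax]]].
  exists (pflat z); split; first exact/inDE.
    by move=> z'; rewrite -(punflatK z') -!LagrE zv; apply/RleP; exact: vmin.
  move=> l' z'; rewrite -(dunflatK l') -(punflatK z') => /inDE l'D /lagr_minE z'm.
  rewrite -!LagrE zv; apply/RleP; apply: vmax l'D _.
  by split; [exists (punflat z')|].
split; first exact/inDE.
rewrite -(punflatK z) in zm zmax.
exists (Lagr P (punflat z) l); split.
  by split; [exists (punflat z)|exact/lagr_minE].
move=> l' v' l'D [[z' <-] z'm]; apply/RleP; rewrite !LagrE.
by apply: zmax; [exact/inDE|exact/lagr_minE].
Qed.

Variable Ld : 'I_(M P) -> R.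
Definition wflat : didx -> R := fun x => wgt P Ld (tag x).

Lemma WquadE l : Wquad P Ld l = wip wflat (dflat l) (dflat l).
Proof.
rewrite /wip sum_didx; apply: eq_bigr => j _.
rewrite RmultE RplusE mulrDr; congr (_ + _); rewrite /sumR;
  rewrite [LHS]mulr_sumr; apply: eq_bigr => k _; by rewrite RpowE expr2.
Qed.

Lemma WnormE l : Wnorm P Ld l = wnorm wflat (dflat l).
Proof. by rewrite /Wnorm RsqrtE WquadE. Qed.

(** The quadratic form of [W] at a standard basis vector is a single weight. *)
Lemma wflat_gt0 : W_posdef P Ld -> forall x, 0 < wflat x.
Proof.
move=> HW x; pose v : didx -> R := fun y => (y == x)%:R.
have -> : wflat x = Wquad P Ld (dunflat v).
  rewrite WquadE dunflatK /wip (bigD1 x)//= big1 => [|y /negbTE yx].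
    by rewrite /v eqxx !mulr1 addr0.
  by rewrite /v yx !mulr0.
apply/RltP/HW; have vx : v x <> 0 by rewrite /v eqxx; apply/eqP; exact: oner_neq0.
by case: x @v vx => j [k|k] v vx; [left|right]; exists j, k.
Qed.

End Flatten.

(** * Strong convexity and smoothness of the separable objective *)

Section BlockGradients.
Local Open Scope ring_scope.
Variable P : problem.
Local Notation R := Rdefinitions.R.

Lemma block_strong_convexity n (sigma : R) (f : vec n -> R) (x y p : vec n) :
  has_grad f x p -> strongly_convex sigma f -> 0 <= sigma ->
  f x + ip p (y - x) + sigma / 2 * ip (y - x) (y - x) <= f y.
Proof.
move=> fgrad fconv; apply: strong_convexity_gradient
  => [e /RltP e0|t /andP[/RleP t0 /RleP t1]].
  have [d [/RltP d0 hd]] := fgrad _ e0; exists d => // h.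
  rewrite -!norm2E => /RltP /hd /RleP; by rewrite RabsE dotE.
have /RleP := fconv y x t (conj t0 t1).
by rewrite norm2E RpowE.
Qed.

Variables (sigma Lf : 'I_(M P) -> R).
Variable gf : forall i : 'I_(M P), vec (nb P i) -> vec (nb P i).
Hypothesis Hgrad : forall i x, has_grad (fb P i) x (gf x).
Hypothesis Hsc : forall i, strongly_convex (sigma i) (fb P i).
Hypothesis HLf : forall i, (0 <= Lf i)%coqR /\ lipschitz (Lf i) (@gf i).

Definition grad_flat (y : pidx P -> R) : pidx P -> R :=
  pflat (fun i => gf (@punflat P y i)).

Lemma ip_pflat (x y : pidx P -> R) :
  ip x y = \sum_(i < M P) ip (@punflat P x i) (@punflat P y i).
Proof. by rewrite /wip sum_pidx. Qed.

Lemma fflat_strong s (x y : pidx P -> R) : 0 < s -> (forall i, s <= sigma i) ->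
  @fflat P x + ip (grad_flat x) (y - x) + s / 2 * ip (y - x) (y - x) <= @fflat P y.
Proof.
move=> s0 sle.
have -> : @fflat P x + ip (grad_flat x) (y - x) + s / 2 * ip (y - x) (y - x) =
    \sum_(i < M P) (fb P i (@punflat P x i) +
      ip (gf (@punflat P x i)) (@punflat P y i - @punflat P x i) +
      s / 2 * ip (@punflat P y i - @punflat P x i) (@punflat P y i - @punflat P x i)).
  by rewrite !ip_pflat mulr_sumr !big_split.
apply: ler_sum => i _.
have := block_strong_convexity (@punflat P y i) (Hgrad (@punflat P x i))
  (@Hsc i) (le_trans (ltW s0) (sle i)).
apply: le_trans.
by rewrite lerD2l ler_wpM2r ?wip_ge0// ler_pM2r ?sle.
Qed.

(** Squared norms add over blocks, so a common bound on the block constants suffices. *)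
Lemma grad_flat_lipschitz L : (forall i, Lf i <= L) -> 0 <= L ->
  forall x y, norm (grad_flat x - grad_flat y) <= L * norm (x - y).
Proof.
move=> LfL L0 x y.
have one_gt0 (T : finType) (j : T) : 0 < (1 : R) by exact: ltr01.
rewrite -ler_sqr ?nnegrE ?mulr_ge0 ?wnorm_ge0// exprMn !wnormE//.
rewrite !ip_pflat mulr_sumr; apply: ler_sum => i _.
have [/RleP Li /(_ (@punflat P x i) (@punflat P y i))/RleP] := @HLf i.
rewrite !norm2E => h; rewrite -!wnormE// -exprMn ler_sqr ?nnegrE ?mulr_ge0 ?wnorm_ge0//.
by apply: le_trans h _; rewrite ler_wpM2r ?wnorm_ge0.
Qed.

End BlockGradients.

Open Scope R_scope.

Theorem theorem1 (P : problem)
  (sigma Lf : 'I_(M P) -> R)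
  (gf : forall i : 'I_(M P), vec (nb P i) -> vec (nb P i))
  (Ld : 'I_(M P) -> R)
  (HE : E_sparsity P)
  (Hsig : forall i, 0 < sigma i)
  (Hgrad : forall i x, has_grad (@fb P i) x (gf i x))
  (Hsc : forall i, strongly_convex (sigma i) (@fb P i))
  (HLf : forall i, 0 <= Lf i /\ lipschitz (Lf i) (gf i))
  (Hrank : A_full_row_rank P)
  (Hslater : slater P)
  (HLd : forall i, exists opn, is_opnorm_block P i opn /\ Ld i = opn ^ 2 / sigma i)
  (HW : W_posdef P Ld) :
  exists c1 c2, 0 < c1 /\ 0 < c2 /\
    forall (lam : dvar P), inD P lam ->
    forall z : pvar P, is_lagr_min P lam z ->
    forall prx : dvar P,
      is_Wproj P Ld (inD P) (dadd P lam (Winv_grad P Ld z)) prx ->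
    forall lbar : dvar P, is_Wproj P Ld (Lstar P) lam lbar ->
    forall T, is_T P Ld lam T ->
      Wnorm P Ld (dsub P lam lbar) <= (c1 + c2 * T ^ 2) * Wnorm P Ld (dsub P prx lam).
Proof.
have sig0 i : (0 < sigma i)%O by exact/RltP.
have [s s0 sle] := uniform_lower_bound sig0.
have [L L0 LfL] : exists2 L : R, (0 < L)%O & forall i, (Lf i <= L)%O.
  apply: uniform_upper_bound => i; exists (1 + Lf i); split.
    by apply: ltr_pwDl => //; apply/RleP; case: (HLf i).
  by move=> D; apply: le_trans; rewrite lerDr.
have w0 := wflat_gt0 HW.
have fs x y := fflat_strong Hgrad Hsc x y s0 sle.
have gl := grad_flat_lipschitz HLf LfL (ltW L0).
have [C C0 hC] := flat_error_bound (Gflat (P := P)) (@gflat P) (@ineq_row P) s0 fs gl w0.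
(* The distance [a] to [lbar] satisfies [a <= T <= 1 + T^2], so [C (1 + a) <= 2 C + C T^2]. *)
exists (C + C), C; split; first by apply/RltP; exact: addr_gt0.
split; first exact/RltP.
move=> lam lamD z zm prx [prxD prxm] lbar [lbarL lbarm] T [_ Tub].
have [zbar ob] := (LstarE lbar).1 lbarL.
have := hC _ _ ((inDE lam).1 lamD) ((lagr_minE lam z).1 zm) _ ((inDE prx).1 prxD) _ _ _ ob.
rewrite -!dflat_dsub -!(WnormE Ld) => hb.
have /RleP aT := Tub _ lbarL.
have a0 : (0 <= Wnorm P Ld (dsub P lam lbar))%O by rewrite WnormE wnorm_ge0.
have e0 : (0 <= Wnorm P Ld (dsub P prx lam))%O by rewrite WnormE wnorm_ge0.
apply/RleP; apply: le_trans (hb _ _) _.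
- move=> y yD; rewrite -(dunflatK y).
  have -> : (fun j => res (Gflat (P := P)) (@gflat P) (pflat z) j / wflat Ld j)%R =
      dflat (Winv_grad P Ld z).
    by rewrite -dflat_res; apply/funext => -[j [k|k]].
  rewrite -dflat_dadd -!dflat_dsub -!WnormE; apply/RleP; apply: prxm.
  by apply/inDE; rewrite dunflatK.
- move=> l1 z1 o1; rewrite -(dunflatK l1) -dflat_dsub -!WnormE; apply/RleP.
  by apply: lbarm; apply/LstarE; exists z1; rewrite dunflatK.
apply: ler_wpM2r => //.
set a := Wnorm P Ld _ in aT a0 *.
rewrite RpowE RplusE RplusE RmultE; move/RltP: C0 => /RltP C0.
have : (a <= 1 + T ^+ 2)%R by nra.
by move=> h; have := ler_wpM2l (ltW C0) h; lra.
Qed.
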